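(* Let $0\le m<n$, let $D$ be a well-defined $n$-diagram and $S$ a well-defined $m$-diagram. Then: (1) if $S=\mathrm{Id}(S).t=s^{n-m}(D)$, then $\mathrm{Id}(S)\circ D=D$; (2) if $t^{n-m}(D)=\mathrm{Id}(S).s=S$, then $D\circ\mathrm{Id}(S)=D$.
   Context: The following notions are defined by mutual recursion on dimension. Signature: for $n\ge 0$, an $n$-signature $\Sigma$ is a family of sets $(\Sigma_0,\dots,\Sigma_n)$ such that, when $n>0$, $(\Sigma_0,\dots,\Sigma_{n-1})$ is an $(n-1)$-signature and each $g\in\Sigma_n$ is equipped with well-defined $(n-1)$-diagrams $g.s,g.t$ over it, satisfying $g.s.s=g.t.s$ and $g.s.t=g.t.t$ when $n>1$. All diagrams are over one fixed signature (a $k$-diagram being over its truncation $(\Sigma_0,\dots,\Sigma_k)$). Diagram: a $0$-diagram $D$ has length $|D|=1$ and consists of one generator $D[0].g\in\Sigma_0$. For $n>0$, an $n$-diagram $D$ consists of a source $(n-1)$-diagram $D.s$ and a list of length $|D|\ge 0$ whose $i$-th entry ($0\le i<|D|$) is a generator $D[i].g\in\Sigma_n$ with an embedding $D[i].e:D[i].g.s\hookrightarrow D[i].d$. Slices: $D[0].d:=D.s$ and $D[i+1].d:=(D[i].d).\Pi[D[i].e,\,D[i].g.t]$ for $0\le i<|D|$. Target: $D.t:=D[|D|].d$. An $n$-diagram is well-defined if $n=0$, or if $n>0$, $D.s$ is well-defined, all embeddings $D[i].e$ are well-defined, and all slices $D[i].d$, $0<i\le|D|$, exist and are well-defined. Two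 $n$-diagrams $S,T$ are globular if $n=0$, or $n>0$ and $S.s=T.s$, $S.t=T.t$. Embedding: an embedding $e:S\hookrightarrow D$ of $n$-diagrams has no data if $n=0$; if $n>0$ it consists of a natural number $e.h\le |D|$ and an embedding $e.e:S.s\hookrightarrow D[e.h].d$. An embedding between well-defined diagrams is well-defined if: for $n=0$, $S[0].g=D[0].g$; for $n>0$, $e.e$ is well-defined and for all $0\le i<|S|$ (with $i+e.h<|D|$) $S[i].g=D[i+e.h].g$ and $(e.e).\Lambda[S[i].d]\circ S[i].e=D[i+e.h].e$. Rewrite: for $e:S\hookrightarrow D$ and $T$ globular with $S$, the $n$-diagram $D.\Pi[e,T]$ is: if $n=0$, the diagram with generator $T[0].g$; if $n>0$, it has source $D.s$, length $|D|-|S|+|T|$, and its $i$-th generator and embedding are: $D[i].g$, $D[i].e$ for $0\le i<e.h$; $T[i-e.h].g$, $(e.e).\Lambda[T[i-e.h].d]\circ T[i-e.h].e$ for $e.h\le i<e.h+|T|$; $D[i-|T|+|S|].g$, $D[i-|T|+|S|].e$ for $e.h+|T|\le i<|D|-|S|+|T|$. Lift: for $e:S\hookrightarrow D$ and $T$ globular with $S$, $e.\Lambda[T]:T\hookrightarrow D.\Pi[e,T]$ has, for $n>0$, $e.\Lambda[T].h=e.h$ and $e.\Lambda[T].e=e.e$ (no data for $n=0$). Composite embedding: for $e:S\hookrightarrow D$, $f:D\hookrightarrow A$, $f\circ e:S\hookrightarrow A$ has, for $n>0$, $(f\circ e).h=e.h+f.h$ and $(f\circ e).e=(f.e).\Lambda[D[e.h].d]\circ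 e.e$ (no data for $n=0$). Equality: two embeddings are equal if their domains and codomains are equal and, for $n>0$, their $.h$ and $.e$ components are equal; two diagrams are equal if their lengths, corresponding generators and, for $n>0$, corresponding embeddings and sources are equal. Iterated boundaries: $s^k(D)$ and $t^k(D)$ denote the result of taking the source, respectively the target, $k$ times. Identity embedding: $D.\mathrm{id}:D\hookrightarrow D$ has no data for $n=0$; for $n>0$, $D.\mathrm{id}.h=0$ and $D.\mathrm{id}.e=D.s.\mathrm{id}$. Identity diagram: for an $n$-diagram $D$, $\mathrm{Id}(D)$ is the $(n+1)$-diagram with source $D$ and length $0$ (so its target is also $D$). Diagram composition and inclusions (mutually recursive): let $S$ be an $m$-diagram and $D$ an $n$-diagram, $m,n\ge 1$. The composite $S\circ D$ exists when either $m\le n$ and $S.t=s^{n-m+1}(D)$, or $m>n$ and $t^{m-n+1}(S)=D.s$; it is the following $\max(m,n)$-diagram. If $m=n$: source $S.s$, length $|S|+|D|$, with $j$-th generator and embedding $S[j].g,S[j].e$ for $0\le j<|S|$ and $D[j-|S|].g,D[j-|S|].e$ for $|S|\le j<|S|+|D|$. If $m<n$: source $S\circ(D.s)$, length $|D|$, $j$-th generator $D[j].g$, $j$-th embedding $\mathrm{Inc}_{\mathrm r}(S,D[j].d)\circ D[j].e$. If $m>n$: source $(S.s)\circ D$, length $|S|$, $j$-th generator $S[j].g$, $j$-th embedding $\mathrm{Inc}_{\mathrm l}(S[j].d,D)\circ S[j].e$. For $m\le n$ the right inclusion $\mathrm{Inc}_{\mathrm r}(S,D):D\hookrightarrow S\circ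 D$ has: if $m=n$, height $|S|$ and component embedding $D.s.\mathrm{id}$; if $m<n$, height $0$ and component embedding $\mathrm{Inc}_{\mathrm r}(S,D.s)$. For $n\le m$ the left inclusion $\mathrm{Inc}_{\mathrm l}(S,D):S\hookrightarrow S\circ D$ has height $0$ and component embedding $S.s.\mathrm{id}$ if $m=n$, and $\mathrm{Inc}_{\mathrm l}(S.s,D)$ if $n<m$. *)

(* Defs.v *)
From mathcomp Require Import all_boot.

Set Implicit Arguments.
Unset Strict Implicit.
Unset Printing Implicit Defensive.

(* The heights e.h, e.e.h, e.e.e.h, ... of an embedding of n-diagrams. *)
Fixpoint heights (n : nat) : Type :=
  match n with
  | 0 => unit
  | p.+1 => (nat * heights p)%type
  end.

(* An embedding dom >-> cod.  Its component e.e is not stored with a domain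
   and codomain of its own: these are determined by dom, cod and e.h, see
   [component]. *)
Record embedding_of (T : Type) (n : nat) : Type :=
  Embedding { dom : T; cod : T; hts : heights n }.

(* n-diagrams with generators in G, before any typing condition.  Every entry
   carries its embedding together with the domain and codomain; [well_defined]
   requires these to be the source of the generator and the slice.  Leibniz
   equality of diagrams is thus equality of the sources, the lengths, the
   generators and the embeddings, the latter with domains and codomains.
   [diagram_of G n] depends only on G 0, ..., G n. *)
Fixpoint diagram_of (G : nat -> Type) (n : nat) : Type :=
  match n with
  | 0 => G 0
  | p.+1 => (diagram_of G p *
             seq (G p.+1 * embedding_of (diagram_of G p) p))%type
  end.

Record presignature : Type := Presignature {
  gen : nat -> Type;
  gsrc : forall n, gen n.+1 -> diagram_of gen n;
  gtgt : forall n, gen n.+1 -> diagram_of gen n }.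

Arguments gsrc {p n} _.
Arguments gtgt {p n} _.

Definition diagram (X : presignature) (n : nat) : Type :=
  diagram_of (gen X) n.

Definition embedding (X : presignature) (n : nat) : Type :=
  embedding_of (diagram X n) n.

Definition src (X : presignature) (n : nat) (D : diagram X n.+1) :
  diagram X n := D.1.

Definition entries (X : presignature) (n : nat) (D : diagram X n.+1) :
  seq (gen X n.+1 * embedding X n) := D.2.

Definition len (X : presignature) (n : nat) (D : diagram X n.+1) : nat :=
  size (entries D).

Definition gen_at (X : presignature) (n : nat) (D : diagram X n.+1)
  (i : 'I_(len D)) : gen X n.+1 := (tnth (in_tuple (entries D)) i).1.

Definition emb_at (X : presignature) (n : nat) (D : diagram X n.+1)
  (i : 'I_(len D)) : embedding X n := (tnth (in_tuple (entries D)) i).2.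

(* e.h *)
Definition height (X : presignature) (n : nat) (e : embedding X n.+1) : nat :=
  (hts e).1.

(* Rewriting in dimension n, the argument rw below, is what slices in
   dimension n.+1 and lifts in dimension n depend on.  In [rw e T] the
   rewritten diagram is cod e; in a well-defined D the codomain of D[i].e is
   D[i].d, so that D[i+1].d is the rewrite of D[i].d. *)
Definition slice_with (X : presignature) (n : nat)
    (rw : embedding X n -> diagram X n -> diagram X n)
    (D : diagram X n.+1) (i : nat) : diagram X n :=
  foldl (fun _ a => rw a.2 (gtgt a.1)) (src D) (take i (entries D)).

Definition component_with (X : presignature) (n : nat)
    (rw : embedding X n -> diagram X n -> diagram X n)
    (e : embedding X n.+1) : embedding X n :=
  Embedding (src (dom e)) (slice_with rw (cod e) (height e)) (hts e).2.

Definition lift_with (X : presignature) (n : nat)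
    (rw : embedding X n -> diagram X n -> diagram X n)
    (e : embedding X n) (T : diagram X n) : embedding X n :=
  Embedding T (rw e T) (hts e).

(* [rewr e T] is D.Pi[e, T] for e : S >-> D, and [ecomp f e] is f o e.  Both
   are total; they have their intended meaning when T is globular with S, and
   when cod e = dom f, respectively. *)
Fixpoint rewr (X : presignature) (n : nat) {struct n} :
    embedding X n -> diagram X n -> diagram X n :=
  match n with
  | 0 => fun _ T => T
  | p.+1 => fun e T =>
      let e' := component_with (@rewr X p) e in
      (src (cod e),
       take (height e) (entries (cod e))
       ++ [seq (gen_at j,
                ecomp (lift_with (@rewr X p) e'
                         (slice_with (@rewr X p) T j))
                      (emb_at j)) | j <- enum 'I_(len T)]
       ++ drop (height e + len (dom e)) (entries (cod e)))
  end
with ecomp (X : presignature) (n : nat) {struct n} :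
    embedding X n -> embedding X n -> embedding X n :=
  match n with
  | 0 => fun f e => @Embedding (diagram X 0) 0 (dom e) (cod f) tt
  | p.+1 => fun f e =>
      @Embedding (diagram X p.+1) p.+1 (dom e) (cod f)
        (height e + height f,
         hts (ecomp (lift_with (@rewr X p) (component_with (@rewr X p) f)
                       (slice_with (@rewr X p) (dom f) (height e)))
                    (component_with (@rewr X p) e)))
  end.

(* D[i].d *)
Definition slice (X : presignature) (n : nat) (D : diagram X n.+1) (i : nat) :
  diagram X n := slice_with (@rewr X n) D i.

(* e.e *)
Definition component (X : presignature) (n : nat) (e : embedding X n.+1) :
  embedding X n := component_with (@rewr X n) e.

(* e.Lambda[T] *)
Definition lift (X : presignature) (n : nat) (e : embedding X n)
  (T : diagram X n) : embedding X n := lift_with (@rewr X n) e T.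

Definition tgt (X : presignature) (n : nat) (D : diagram X n.+1) :
  diagram X n := slice D (len D).

(* Two dimensions m <= n are written m and k + m, so that no transport along
   an equation between dimensions is needed; here k = n - m. *)
Fixpoint srcs (X : presignature) (m k : nat) : diagram X (k + m) -> diagram X m :=
  match k with
  | 0 => fun D => D
  | k'.+1 => fun D => @srcs X m k' (src D)
  end.

Fixpoint tgts (X : presignature) (m k : nat) : diagram X (k + m) -> diagram X m :=
  match k with
  | 0 => fun D => D
  | k'.+1 => fun D => @tgts X m k' (tgt D)
  end.

Definition globular (X : presignature) (n : nat) :
    diagram X n -> diagram X n -> Prop :=
  match n with
  | 0 => fun _ _ => True
  | p.+1 => fun S T => src S = src T /\ tgt S = tgt T
  end.

(* The index i + e.h is required to be an index of cod e. *)
Fixpoint well_defined_emb (X : presignature) (n : nat) : embedding X n -> Prop :=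
  match n with
  | 0 => fun e => dom e = cod e
  | p.+1 => fun e =>
      [/\ height e <= len (cod e),
          well_defined_emb (component e) &
          forall i : 'I_(len (dom e)),
          exists j : 'I_(len (cod e)),
          [/\ j = i + height e :> nat,
              gen_at i = gen_at j &
              ecomp (lift (component e) (slice (dom e) i)) (emb_at i)
              = emb_at j]]
  end.

Fixpoint well_defined (X : presignature) (n : nat) : diagram X n -> Prop :=
  match n with
  | 0 => fun _ => True
  | p.+1 => fun D =>
      [/\ well_defined (src D),
          forall i : 'I_(len D),
            [/\ dom (emb_at i) = gsrc (gen_at i),
                cod (emb_at i) = slice D i &
                well_defined_emb (emb_at i)] &
          forall i : nat, 0 < i <= len D -> well_defined (slice D i)]
  end.

Fixpoint is_signature (X : presignature) (n : nat) : Prop :=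
  match n with
  | 0 => True
  | p.+1 => is_signature X p /\
      forall g : gen X p.+1,
        [/\ well_defined (gsrc g), well_defined (gtgt g) &
            globular (gsrc g) (gtgt g)]
  end.

(* An N-signature; the sets and boundaries in dimensions above N are
   unconstrained, and no diagram of dimension at most N mentions them. *)
Record signature (N : nat) : Type := Signature {
  presig :> presignature;
  presigP : is_signature presig N }.

Fixpoint id_hts (n : nat) : heights n :=
  match n with
  | 0 => tt
  | p.+1 => (0, id_hts p)
  end.

Definition id_emb (X : presignature) (n : nat) (D : diagram X n) :
  embedding X n := Embedding D D (id_hts n).

Definition Id (X : presignature) (n : nat) (D : diagram X n) :
  diagram X n.+1 := (D, [::]).

(* The composite S o D of diagrams of the same dimension. *)
Definition comp_eq (X : presignature) (m : nat) (S D : diagram X m.+1) :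
  diagram X m.+1 := (src S, entries S ++ entries D).

(* Heights of the right inclusion of D into S o D, for S and D of dimensions
   m+1 and k+m+1. *)
Fixpoint inc_r_hts (X : presignature) (m k : nat) (S : diagram X m.+1) :
    diagram X (k + m).+1 -> heights (k + m).+1 :=
  match k with
  | 0 => fun D => (len S, hts (id_emb (src D)))
  | k'.+1 => fun D => (0, @inc_r_hts X m k' S (src D))
  end.

(* S o D for S and D of dimensions m+1 and k+m+1. *)
Fixpoint comp_le (X : presignature) (m k : nat) (S : diagram X m.+1) :
    diagram X (k + m).+1 -> diagram X (k + m).+1 :=
  match k with
  | 0 => fun D => comp_eq S D
  | k'.+1 => fun D =>
      let inc_r D' := Embedding D' (@comp_le X m k' S D') (inc_r_hts S D') in
      (@comp_le X m k' S (src D),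
       [seq (gen_at j, ecomp (inc_r (slice D j)) (emb_at j))
       | j <- enum 'I_(len D)])
  end.

Definition inc_r (X : presignature) (m k : nat) (S : diagram X m.+1)
    (D : diagram X (k + m).+1) : embedding X (k + m).+1 :=
  Embedding D (comp_le S D) (inc_r_hts S D).

(* Heights of the left inclusion of S into S o D, for S and D of dimensions
   k+m+1 and m+1. *)
Fixpoint inc_l_hts (X : presignature) (m k : nat) :
    diagram X (k + m).+1 -> heights (k + m).+1 :=
  match k with
  | 0 => fun S => (0, hts (id_emb (src S)))
  | k'.+1 => fun S => (0, @inc_l_hts X m k' (src S))
  end.

(* S o D for S and D of dimensions k+m+1 and m+1. *)
Fixpoint comp_ge (X : presignature) (m k : nat) :
    diagram X (k + m).+1 -> diagram X m.+1 -> diagram X (k + m).+1 :=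
  match k with
  | 0 => fun S D => comp_eq S D
  | k'.+1 => fun S D =>
      let inc_l S' := Embedding S' (@comp_ge X m k' S' D) (inc_l_hts S') in
      (@comp_ge X m k' (src S) D,
       [seq (gen_at j, ecomp (inc_l (slice S j)) (emb_at j))
       | j <- enum 'I_(len S)])
  end.

Definition inc_l (X : presignature) (m k : nat) (S : diagram X (k + m).+1)
    (D : diagram X m.+1) : embedding X (k + m).+1 :=
  Embedding S (comp_ge S D) (inc_l_hts S).

(* Main.v *)
(** An inclusion into a composite with an identity diagram is the identity
    embedding, so the composite has the entries of [D] with [id_emb] composed
    onto their embeddings.  The identity embedding is a left unit for [ecomp]
    because rewriting along it replaces the whole diagram; these two facts are
    proved by a joint induction on the dimension. *)

Require Import Defs.
From mathcomp Require Import all_boot.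

Set Implicit Arguments.
Unset Strict Implicit.
Unset Printing Implicit Defensive.

(** The half of globularity that matters for rewriting along an identity: in positive dimension
    [rewr] keeps the source of the codomain, so the result can be [T] only if [T] shares that
    source. *)
Definition same_src (X : presignature) (n : nat) :
    diagram X n -> diagram X n -> Prop :=
  match n with
  | 0 => fun _ _ => True
  | p.+1 => fun A B => src A = src B
  end.

Lemma map_gen_emb_at (X : presignature) (n : nat) (D : diagram X n.+1) :
  [seq (gen_at j, emb_at j) | j <- enum 'I_(len D)] = entries D.
Proof.
rewrite -[RHS](map_tnth_enum (in_tuple (entries D))).
by apply: eq_map => j; rewrite /gen_at /emb_at -surjective_pairing.
Qed.

Lemma map_entries_id (X : presignature) (n : nat) (D : diagram X n.+1)
    (f : 'I_(len D) -> embedding X n) :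
  (forall j, f j = emb_at j) ->
  [seq (gen_at j, f j) | j <- enum 'I_(len D)] = entries D.
Proof.
by move=> fE; rewrite -[RHS]map_gen_emb_at; apply: eq_map => j; rewrite fE.
Qed.

Lemma sliceS (X : presignature) (n : nat) (D : diagram X n.+1)
    (i : 'I_(len D)) :
  slice D i.+1 = rewr (emb_at i) (gtgt (gen_at i)).
Proof.
have x0 := tnth (in_tuple (entries D)) i.
rewrite /slice /slice_with (take_nth x0) ?ltn_ord // foldl_rcons.
by rewrite /emb_at /gen_at (tnth_nth x0).
Qed.

(** Slices are total in the index and stay at the target past the end, which reduces the facts on
    slices below to indices up to the length. *)
Lemma slice_oversize (X : presignature) (n : nat) (D : diagram X n.+1) i :
  len D <= i -> slice D i = slice D (len D).
Proof. by move=> leDi; rewrite /slice /slice_with !take_oversize. Qed.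

Lemma slice0 (X : presignature) (n : nat) (D : diagram X n.+1) :
  slice D 0 = src D.
Proof. by rewrite /slice /slice_with take0. Qed.

Lemma well_defined_slice (X : presignature) (n : nat) (D : diagram X n.+1) i :
  well_defined D -> well_defined (slice D i).
Proof.
move=> [wdS _ wd]; wlog le_i : i / i <= len D.
  move=> th; case: (leqP i (len D)) => [/th //|/ltnW/slice_oversize ->].
  exact: th.
by case: i le_i => [_|i le_i]; [rewrite slice0 | apply: wd].
Qed.

(** Each slice is a rewrite of the one before it, and a rewrite takes its source from the diagram
    rewritten. *)
Lemma same_src_slice (X : presignature) (n : nat) (D : diagram X n.+1) i :
  well_defined D -> same_src (slice D i) (src D).
Proof.
move=> [_ wd _]; wlog le_i : i / i <= len D.
  move=> th; case: (leqP i (len D)) => [/th //|/ltnW/slice_oversize ->].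
  exact: th.
elim: i le_i => [_|i IHi lt_i]; first by rewrite slice0; case: n D wd.
have [_ cod_i _] := wd (Ordinal lt_i).
have := IHi (ltnW lt_i); rewrite (sliceS (Ordinal lt_i)) -[i]/(val (Ordinal lt_i)).
rewrite -cod_i; move: (emb_at _) (gtgt _).
by case: n D {IHi wd lt_i cod_i} => [|n] D e T.
Qed.

Lemma id_emb_unit (X : presignature) (n : nat) :
  (forall e : embedding X n,
     well_defined (cod e) -> ecomp (id_emb (cod e)) e = e) /\
  (forall B T : diagram X n,
     well_defined T -> same_src T B -> rewr (id_emb B) T = T).
Proof.
elim: n => [|n [IHecomp IHrewr]].
  by split=> // -[d c []].
(* A lift keeps the heights, and the rewriting half of the induction hypothesis makes its codomain
   [T]. *)
have lift_id (A T : diagram X n) :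
    well_defined T -> same_src T A -> Defs.lift (id_emb A) T = id_emb T.
  by move=> wdT sTA; rewrite /Defs.lift /lift_with IHrewr.
have component_id (A : diagram X n.+1) :
    component (id_emb A) = id_emb (src A).
  by rewrite /component /component_with -/(slice _ _) slice0.
split=> [e wde | B T wdT sTB].
  have wdh := well_defined_slice (height e) wde.
  have IHe : ecomp (id_emb (slice (cod e) (height e))) (component e)
             = component e by apply: (IHecomp (component e)).
  rewrite [LHS]/= -/(component _) -/(slice _ _) -/(Defs.lift _ _).
  rewrite -/(component e) component_id lift_id //; last exact: same_src_slice.
  by rewrite IHe addn0; case: e {wde wdh IHe} => ? ? [].
rewrite /= -/(component _) component_id.
(* The identity has height 0 and covers all of [B], so no entry of [B] survives before or after
   those of [T]. *)
rewrite /height /= take0 add0n drop_size cats0 -sTB.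
rewrite [RHS]surjective_pairing; congr pair.
apply: map_entries_id => j.
rewrite -/(slice _ _) -/(Defs.lift _ _) lift_id; last 2 first.
- exact: well_defined_slice.
- exact: same_src_slice.
(* The codomain of [emb_at j] is [slice T j], so the goal is the unit law one dimension lower. *)
have [_ wd _] := wdT; have [_ cod_j _] := wd j.
by rewrite -cod_j IHecomp // cod_j; apply: well_defined_slice.
Qed.

Lemma ecomp_id (X : presignature) (n : nat) (D : diagram X n.+1)
    (j : 'I_(len D)) :
  well_defined D -> ecomp (id_emb (slice D j)) (emb_at j) = emb_at j.
Proof.
move=> wdD; have [_ wd _] := wdD; have [_ cod_j _] := wd j.
rewrite -cod_j (id_emb_unit X n).1 // cod_j; exact: well_defined_slice.
Qed.

(** At [k = 0] the first height is the length of the left factor, here 0. *)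
Lemma inc_r_hts_Id (X : presignature) (m k : nat) (S : diagram X m)
    (D : diagram X (k + m).+1) :
  inc_r_hts (Id S) D = id_hts (k + m).+1.
Proof. by elim: k D => //= k IHk D; rewrite IHk. Qed.

Lemma inc_l_htsE (X : presignature) (m k : nat) (D : diagram X (k + m).+1) :
  inc_l_hts D = id_hts (k + m).+1.
Proof. by elim: k D => //= k IHk D; rewrite IHk. Qed.

Lemma comp_le_Id (X : presignature) (m k : nat) (S : diagram X m)
    (D : diagram X (k + m).+1) :
  well_defined D -> S = srcs (k := k.+1) D -> comp_le (Id S) D = D.
Proof.
elim: k D => [|k IHk] D wdD SE.
  by rewrite /= /comp_eq /= SE -surjective_pairing.
have [wdsD _ _] := wdD.
rewrite [RHS]surjective_pairing /= IHk //; congr pair.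
apply: map_entries_id => j.
(* By induction the inclusion of [slice D j] has codomain [slice D j]; with the heights of an
   identity it is [id_emb (slice D j)]. *)
rewrite inc_r_hts_Id IHk; first exact: ecomp_id.
  exact: well_defined_slice.
(* The iterated source factors through [src], on which [slice D j] and [src D] agree. *)
by have /= -> := same_src_slice (D := D) j wdD.
Qed.

Lemma comp_ge_Id (X : presignature) (m k : nat) (S : diagram X m)
    (D : diagram X (k + m).+1) :
  well_defined D -> comp_ge D (Id S) = D.
Proof.
elim: k D => [|k IHk] D wdD.
  by rewrite /= /comp_eq /= cats0 -surjective_pairing.
have [wdsD _ _] := wdD.
rewrite [RHS]surjective_pairing /= IHk //; congr pair.
apply: map_entries_id => j.
rewrite inc_l_htsE IHk; first exact: ecomp_id.
exact: well_defined_slice.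
Qed.

Theorem lemma92 (N : nat) (Sigma : signature N) (m k : nat)
    (hN : k.+1 + m <= N)
    (D : diagram Sigma (k.+1 + m)) (S : diagram Sigma m)
    (hD : well_defined D) (hS : well_defined S) :
  (S = tgt (Id S) -> tgt (Id S) = srcs (k := k.+1) D ->
     comp_le (k := k) (Id S) D = D) /\
  (tgts (k := k.+1) D = src (Id S) -> src (Id S) = S ->
     comp_ge (k := k) D (Id S) = D).
Proof.
(* [tgt (Id S)] computes to [S], so composability is the boundary hypothesis of [comp_le_Id]. *)
by split=> [_ ? | _ _]; [apply: comp_le_Id | apply: comp_ge_Id].
Qed.
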